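(* Let $F$ be an algebraically closed field of characteristic $p>2$, let $k\geq 0$ be an integer, and put $s=2k+1$ and $m=sp$. Let $\mathcal{X}$ be the hyperelliptic curve over $F$ given by the affine equation $y^2=x^m+x$. Then the $a$-number of $\mathcal{X}$ equals $$\dfrac{(k+1)(p-1)}{2}.$$
   Context: The curve $\mathcal{X}$ given by an affine equation $y^2=f(x)$, with $f$ a polynomial without multiple roots, means the nonsingular projective curve over $F$ with function field $F(x,y)$, $y^2=f(x)$. The $a$-number $a(\mathcal{X})$ of a nonsingular, projective, irreducible curve $\mathcal{X}$ over $F$ is the $a$-number of its Jacobian $\mathcal{J}_{\mathcal{X}}$, i.e. the dimension over $F$ of $\mathrm{Hom}(\alpha_p,\mathcal{J}_{\mathcal{X}})$, where $\alpha_p$ is the group scheme $\mathrm{Spec}(F[X]/(X^p))$ with co-multiplication $X\mapsto 1\otimes X+X\otimes 1$. Equivalently, $a(\mathcal{X})$ is the dimension of the $F$-vector space of exact holomorphic differentials on $\mathcal{X}$, i.e. the dimension of the kernel of the Cartier operator $\mathscr{C}$ on $H^0(\mathcal{X},\Omega^1)$. Here, for a separating variable $x$ of the function field $K$ of $\mathcal{X}$, every differential can be written $\omega=(f_0^p+f_1^px+\cdots+f_{p-1}^px^{p-1})dx$ with $f_i\in K$, and $\mathscr{C}(\omega)=f_{p-1}dx$ (independent of the choice of $x$). *)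

(* Defs.v *)
From mathcomp Require Import all_boot all_algebra polyXY separable.

Set Implicit Arguments.
Unset Strict Implicit.
Unset Printing Implicit Defensive.

Import GRing.Theory.
Local Open Scope ring_scope.

(* A function field K/F is given by an embedding iota : F -> K. The nonsingular
   projective curve with function field K is represented by its set of places,
   i.e. of valuation rings of K/F. *)

Definition transcendental (F K : fieldType) (iota : {rmorphism F -> K})
    (t : K) : Prop :=
  forall q : {poly F}, q != 0 -> (map_poly iota q).[t] != 0.

(* z belongs to the subfield F(t). *)
Definition in_adjoin (F K : fieldType) (iota : {rmorphism F -> K})
    (t z : K) : Prop :=
  exists a b : {poly F}, (map_poly iota b).[t] != 0 /\
    z = (map_poly iota a).[t] / (map_poly iota b).[t].

(* K = F(x, y) with x transcendental over F and y ^ 2 = f(x). When f is not a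
   square in F[x], this determines (K, x, y) up to F-isomorphism. *)
Definition hyperelliptic_function_field (F K : fieldType)
    (iota : {rmorphism F -> K}) (f : {poly F}) (x y : K) : Prop :=
  [/\ transcendental iota x,
      y ^+ 2 = (map_poly iota f).[x]
    & forall z : K, exists a b : {poly {poly F}},
        (map_poly (map_poly iota) b).[x, y] != 0 /\
        z = (map_poly (map_poly iota) a).[x, y] /
            (map_poly (map_poly iota) b).[x, y]].

(* t is a separating variable: K / F(t) is separable algebraic. *)
Definition separating (F K : fieldType) (iota : {rmorphism F -> K})
    (t : K) : Prop :=
  forall z : K, exists q : {poly K},
    [/\ separable_poly q, root q z & forall i, in_adjoin iota t q`_i].

(* In a function field of one variable these are exactly the local rings of the
   closed points of the nonsingular projective model; discreteness of the
   valuation is automatic there. *)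
Definition is_place (F K : fieldType) (iota : {rmorphism F -> K})
    (O : K -> Prop) : Prop :=
  [/\ forall c : F, O (iota c),
      forall u v : K, O u -> O v -> O (u - v) /\ O (u * v),
      forall u : K, u != 0 -> O u \/ O u^-1
    & exists u : K, ~ O u].

Definition is_derivation (F K : fieldType) (iota : {rmorphism F -> K})
    (M : lmodType K) (D : K -> M) : Prop :=
  [/\ forall u v : K, D (u + v) = D u + D v,
      forall u v : K, D (u * v) = u *: D v + v *: D u
    & forall c : F, D (iota c) = 0].

(* (Omega, d) is the module of Kaehler differentials of K/F. *)
Definition is_kaehler (F K : fieldType) (iota : {rmorphism F -> K})
    (Omega : lmodType K) (d : K -> Omega) : Prop :=
  is_derivation iota d /\
  forall (M : lmodType K) (D : K -> M), is_derivation iota D ->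
    (exists phi : {linear Omega -> M}, forall u : K, phi (d u) = D u) /\
    (forall phi psi : {linear Omega -> M},
       (forall u : K, phi (d u) = psi (d u)) ->
       forall omega : Omega, phi omega = psi omega).

(* The stalk at O of the sheaf of differentials: the image in Omega of the
   Kaehler differentials of O/F, that is, the O-span of d(O). For a local
   parameter t at O this is O dt. *)
Definition regular_at (K : fieldType) (Omega : lmodType K) (d : K -> Omega)
    (O : K -> Prop) (omega : Omega) : Prop :=
  exists (n : nat) (g h : 'I_n -> K),
    (forall i, O (g i) /\ O (h i)) /\ omega = \sum_i g i *: d (h i).

(* omega belongs to H^0(X, Omega^1). *)
Definition holomorphic (F K : fieldType) (iota : {rmorphism F -> K})
    (Omega : lmodType K) (d : K -> Omega) (omega : Omega) : Prop :=
  forall O : K -> Prop, is_place iota O -> regular_at d O omega.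

(* The graph of the Cartier operator in characteristic p. *)
Definition cartier (F K : fieldType) (iota : {rmorphism F -> K}) (p : nat)
    (Omega : lmodType K) (d : K -> Omega) (omega eta : Omega) : Prop :=
  exists (t : K) (f : nat -> K),
    [/\ separating iota t,
        omega = (\sum_(0 <= i < p) f i ^+ p * t ^+ i) *: d t
      & eta = f p.-1 *: d t].

(* V, viewed as a subset of the F-module obtained from Omega by restriction of
   scalars along iota, is an F-subspace of dimension n. *)
Definition has_dim (F K : fieldType) (iota : {rmorphism F -> K})
    (Omega : lmodType K) (V : Omega -> Prop) (n : nat) : Prop :=
  exists e : 'I_n -> Omega,
    (forall c : 'I_n -> F,
       \sum_i iota (c i) *: e i = 0 -> forall i, c i = 0) /\
    (forall omega : Omega,
       V omega <-> exists c : 'I_n -> F, omega = \sum_i iota (c i) *: e i).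

(* The a-number of the curve with function field K/F, in characteristic p, is
   n. It is taken as the dimension of the kernel of the Cartier operator on
   holomorphic differentials, which equals dim_F Hom(alpha_p, Jacobian). The
   pair (Omega, d) is unique up to unique isomorphism, so any one will do. *)
Definition has_a_number (F K : fieldType) (iota : {rmorphism F -> K})
    (p n : nat) : Prop :=
  exists (Omega : lmodType K) (d : K -> Omega),
    is_kaehler iota d /\
    has_dim iota
      (fun omega => holomorphic iota d omega /\ cartier iota p d omega 0) n.

(* Main.v *)
From HB Require Import structures.
Require Import Defs.
From mathcomp Require Import all_boot all_algebra polyXY separable ring zify.

Set Implicit Arguments.
Unset Strict Implicit.
Unset Printing Implicit Defensive.

Import GRing.Theory.
Local Open Scope ring_scope.

(** Write h = (p - 1) / 2 and g = (m - 1) / 2 = k p + h, and let f = X^m + X.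
    As p divides m, f has derivative 1; this makes the curve y^2 = f(x) easy to
    handle by hand.  The function field is F(x) + F(x) y.

    Holomorphic differentials.  They are the a(x) dx / y with deg a < g.  Since
    2 y dy = dx, the differential a(x) dx / y = 2 a(x) dy is regular wherever x
    is ([regular_finite]).  Conversely, the local rings of the affine points are
    places ([local_ring_place]); at each of them y dh is a regular multiple of
    dx, so a holomorphic u dx has u y regular at every affine point, and such a
    function lies in F[x] + F[x] y ([regular_pval_line]).  The point at infinity
    needs no separate study: 1/x and y / x^(g+1) satisfy the same equation
    ([model_inv]), so the involution x -> 1/x moves that point to the origin.
    Comparing the two descriptions of u dx bounds the degree of the numerator
    ([holomorphic_numerator], [holomorphic_pval]).

    Kaehler differentials and the Cartier operator.  The field K is generated
    by x over its subfield of p-th powers ([frob_val_surj]), so the derivation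
    d/dx makes K itself the module of Kaehler differentials
    ([coordinate_kaehler]), and a differential is killed by the Cartier operator
    exactly when it is exact ([cartier0_exact], [exact_cartier0]).

    Counting.  Because y^p = f^h y, the differential a(x) dx / y is exact iff
    a f^h dx is, that is, iff a f^h has no monomial of exponent congruent to
    p - 1 modulo p ([exact_quotient], [exact_pval]).  Expanding
    f^h = sum_j C(h, j) X^(h - j + m j), each such coefficient of a f^h involves a
    single coefficient of a when deg a < g, and the condition becomes: a has no
    monomial whose exponent is congruent modulo p to one of h, ..., p - 1
    ([hasse_kernel]).  What remains are the exponents i p + r with 0 <= i <= k and
    0 <= r < h, in number (k + 1) h = (k + 1) (p - 1) / 2. *)

(** * Values of polynomials in one and two variables *)

Section PolynomialValues.
Context (F K : fieldType) (iota : {rmorphism F -> K}).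

Definition pval (x : K) : {rmorphism {poly F} -> K} :=
  horner_eval x \o map_poly iota.

(** A bivariate polynomial is a polynomial in y over F[x]; [phi] says where
    F[x] goes.  The two cases of interest are the generic point (x, y) and the
    affine points of the curve. *)
Definition bval (R : comNzRingType) (phi : {rmorphism {poly F} -> R}) (y : R) :
  {rmorphism {poly {poly F}} -> R} := horner_eval y \o map_poly phi.

Lemma pvalE x a : (map_poly iota a).[x] = pval x a. Proof. by []. Qed.

Lemma pvalX x : pval x 'X = x.
Proof. by rewrite -pvalE map_polyX hornerX. Qed.

Lemma pvalXn x n : pval x 'X^n = x ^+ n.
Proof. by rewrite rmorphXn pvalX. Qed.

Lemma pvalC x c : pval x c%:P = iota c.
Proof. by rewrite -pvalE map_polyC hornerC. Qed.

Lemma bvalX (R : comNzRingType) (phi : {rmorphism {poly F} -> R}) y :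
  bval phi y 'X = y.
Proof. by rewrite /bval /= /horner_eval map_polyX hornerX. Qed.

Lemma bvalC (R : comNzRingType) (phi : {rmorphism {poly F} -> R}) y a :
  bval phi y a%:P = phi a.
Proof. by rewrite /bval /= /horner_eval map_polyC hornerC. Qed.

Lemma bval_line (R : comNzRingType) (phi : {rmorphism {poly F} -> R}) y a b :
  bval phi y (a%:P + b%:P * 'X) = phi a + phi b * y.
Proof. by rewrite rmorphD rmorphM bvalX !bvalC. Qed.

End PolynomialValues.
Arguments pval {F K} iota x : simpl never.
Arguments bval {F R} phi y : simpl never.

(** The parity of degrees: y is not in F(x) when f has odd degree. *)
Lemma odd_sqr_eq (F : fieldType) (f a b : {poly F}) : odd (size f).-1 ->
  a ^+ 2 = b ^+ 2 * f -> a = 0 /\ b = 0.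
Proof.
move=> oddf ab0.
have [b0|nzb] := eqVneq b 0.
  by move: ab0; rewrite b0 expr0n /= mul0r => /eqP; rewrite expf_eq0 => /eqP.
have nzf : f != 0 by apply: contraTneq oddf => ->; rewrite size_poly0.
have nza : a != 0.
  apply: contraTneq isT => a0; move/eqP: ab0; rewrite a0 expr0n /= eq_sym.
  by rewrite mulf_eq0 expf_eq0 (negPf nzb) (negPf nzf).
move/(congr1 (fun q : {poly F} => odd (size q).-1)): ab0.
rewrite !expr2 !size_mul ?mulf_neq0 //.
move: (oddf) nza nzb nzf; rewrite -!size_poly_gt0.
by case: (size f) (size a) (size b) => [|n] [|i] [|j] //=; lia.
Qed.

Lemma eq0_of_conj (F : fieldType) (u v : F) :
  2 != 0 :> F -> u + v = 0 -> u - v = 0 -> u = 0.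
Proof.
move=> nz2 uDv uBv; apply: (mulfI nz2); rewrite mulr0.
by transitivity (u + v + (u - v)); [ring | rewrite uDv uBv addr0].
Qed.

(** * The affine curve *)

Section Model.
Context (F : closedFieldType) (K : fieldType) (iota : {rmorphism F -> K}).

(** K is the function field of y^2 = f(x), with the fractions put in the normal
    form (a(x) + b(x) y) / c(x). *)
Definition model (f : {poly F}) (x y : K) : Prop :=
  [/\ forall a, a != 0 -> pval iota x a != 0,
      y ^+ 2 = pval iota x f
    & forall z, exists a b c, c != 0 /\
        z * pval iota x c = pval iota x a + pval iota x b * y].

Context (f : {poly F}) (x y : K).
Hypotheses (oddf : odd (size f).-1) (mod_xy : model f x y).
Local Notation E := (pval iota x).
Local Notation V := (bval (pval iota x) y).

Lemma pval_eq0 a : (E a == 0) = (a == 0).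
Proof.
case: mod_xy => tr _ _; apply/idP/idP=> [|/eqP->]; last by rewrite rmorph0.
by apply: contraLR => /tr.
Qed.

Lemma pval_inj a b : E a = E b -> a = b.
Proof.
by move=> /eqP; rewrite -subr_eq0 -rmorphB pval_eq0 subr_eq0 => /eqP.
Qed.

Lemma model_sqr : y ^+ 2 = E f. Proof. by case: mod_xy. Qed.

Lemma split_eq0 a b : E a + E b * y = 0 -> a = 0 /\ b = 0.
Proof.
move=> ab0; apply: (odd_sqr_eq oddf); apply: pval_inj.
rewrite rmorphXn rmorphM rmorphXn -model_sqr.
by move/eqP: ab0; rewrite addr_eq0 => /eqP->; ring.
Qed.

Lemma model_ordinate_neq0 : y != 0.
Proof.
have: y ^+ 2 != 0; last by rewrite expf_eq0.
rewrite model_sqr pval_eq0.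
by apply: contraTneq oddf => ->; rewrite size_poly0.
Qed.

Lemma bivariate_red (P : {poly {poly F}}) :
  exists a b Q, P = a%:P + b%:P * 'X + Q * ('X^2 - f%:P).
Proof.
elim/poly_ind: P => [|P c [a [b [Q ->]]]].
  by exists 0, 0, 0; rewrite !mul0r !addr0.
exists (b * f + c), a, (b%:P + Q * 'X); rewrite rmorphD rmorphM /=; ring.
Qed.

Lemma bval_red (R : comNzRingType) (phi : {rmorphism {poly F} -> R}) z a b Q :
    z ^+ 2 = phi f ->
  bval phi z (a%:P + b%:P * 'X + Q * ('X^2 - f%:P)) = phi a + phi b * z.
Proof.
move=> fz; rewrite 2!rmorphD !rmorphM rmorphB rmorphXn !bvalX !bvalC fz.
by rewrite subrr mulr0 addr0.
Qed.

(** A polynomial relation between x and y holds at every point of the curve: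
    modulo y^2 - f(x) it reduces to a + b y, which vanishes only if a = b = 0. *)
Lemma specialize al be P :
  be ^+ 2 = f.[al] -> V P = 0 -> bval (horner_eval al) be P = 0.
Proof.
move=> pt; have [a [b [Q ->]]] := bivariate_red P.
rewrite !bval_red //; last exact: model_sqr.
by move/split_eq0=> [-> ->]; rewrite !rmorph0 mul0r addr0.
Qed.

(** The functions on the curve that are regular at the point (al, be). *)
Definition local_ring (al be : F) (z : K) : Prop :=
  exists A B, bval (horner_eval al) be B != 0 /\ z * V B = V A.

Section Point.
Context (al be : F).
Hypotheses (pt : be ^+ 2 = f.[al]).
Local Notation O := (local_ring al be).
Local Notation ev := (bval (horner_eval al) be).

Lemma bval_neq0 B : ev B != 0 -> V B != 0.
Proof. by apply: contra_neq => /(specialize pt). Qed.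

Lemma local_ring_bval A : O (V A).
Proof. by exists A, 1; rewrite !rmorph1 oner_eq0 mulr1. Qed.

Lemma local_ring_pval a : O (E a).
Proof. by rewrite -(bvalC E y); apply: local_ring_bval. Qed.

Lemma local_ring_const c : O (iota c).
Proof. by rewrite -(pvalC iota x); apply: local_ring_pval. Qed.

Lemma local_ringM u v : O u -> O v -> O (u * v).
Proof.
move=> [A [B [nzB uB]]] [A' [B' [nzB' vB]]]; exists (A * A'), (B * B').
by rewrite !rmorphM mulf_neq0 // mulrACA uB vB.
Qed.

Lemma local_ringB u v : O u -> O v -> O (u - v).
Proof.
move=> [A [B [nzB uB]]] [A' [B' [nzB' vB]]].
exists (A * B' - A' * B), (B * B').
by rewrite rmorphB !rmorphM mulf_neq0 // -uB -vB; split=> //; ring.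
Qed.

Lemma local_ringD u v : O u -> O v -> O (u + v).
Proof.
move=> Ou Ov; rewrite -[v]opprK -[- v]sub0r -(rmorph0 iota).
by apply: local_ringB Ou _; apply: local_ringB Ov; apply: local_ring_const.
Qed.

Lemma local_ringV B : ev B != 0 -> O (V B)^-1.
Proof.
by move=> nzB; exists 1, B; rewrite rmorph1 mulVf //; apply: bval_neq0.
Qed.

Lemma local_ring_frac z A B : z * V B = V A -> ev B != 0 -> O z.
Proof. by exists A, B. Qed.

Lemma local_ring_frac_inv z A B : z * V B = V A -> ev A != 0 -> O z^-1.
Proof.
move=> zB nzA; exists B, A; split=> //; rewrite -zB mulKf //.
by apply: contraTneq (bval_neq0 nzA) => z0; rewrite -zB z0 mul0r eqxx.
Qed.

Lemma XsubC_pval_neq0 : E ('X - al%:P) != 0.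
Proof. by rewrite pval_eq0 polyXsubC_eq0. Qed.

Lemma zero_factor (c : {poly F}) : c.[al] = 0 -> exists c1, c = c1 * ('X - al%:P).
Proof. by move/eqP/factor_theorem. Qed.

Lemma ev_line a b : ev (a%:P + b%:P * 'X) = a.[al] + b.[al] * be.
Proof. exact: bval_line. Qed.

Lemma cancel_XsubC z a b c :
    z * E (c * ('X - al%:P)) = E (a * ('X - al%:P)) + E (b * ('X - al%:P)) * y ->
  z * E c = E a + E b * y.
Proof.
rewrite !rmorphM => zE; apply: (mulIf XsubC_pval_neq0).
by rewrite -mulrA zE; ring.
Qed.

Lemma size_cofactor n (c : {poly F}) :
  (size (c * ('X - al%:P))%R <= n.+1)%N -> c * ('X - al%:P) != 0 ->
  (size c <= n)%N /\ c != 0.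
Proof.
move=> szc nzc; have nzc1 : c != 0 by apply: contraNneq nzc => ->; rewrite mul0r.
by move: szc; rewrite size_mul ?polyXsubC_eq0 // size_XsubC addn2.
Qed.

Hypotheses (nz2 : 2 != 0 :> F) (df : f^`() = 1).

(** At a branch point f vanishes, and only to first order since f' = 1. *)
Lemma ramified_cofactor f1 : f = f1 * ('X - al%:P) -> f1.[al] = 1.
Proof.
move=> def_f; have := congr1 (fun q => q.[al]) df.
by rewrite def_f derivM derivXsubC !hornerE subrr mulr0 add0r.
Qed.

(** At a branch point y, and not x - al, is a local parameter; multiplying a
    fraction by y lets the common factor x - al of a, c and f cancel. *)
Lemma ramified_frac z a b c f1 : be = 0 -> f = f1 * ('X - al%:P) ->
    z * E (c * ('X - al%:P)) = E (a * ('X - al%:P)) + E b * y ->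
  z * V (c%:P * 'X) = V ((b * f1)%:P + a%:P * 'X).
Proof.
move=> be0 def_f zE; apply: (mulIf XsubC_pval_neq0).
transitivity (z * E (c * ('X - al%:P)) * y); first by rewrite !rmorphM bvalC bvalX; ring.
rewrite zE mulrDl -mulrA -expr2 model_sqr bval_line def_f; ring.
Qed.

(** This is where nonsingularity enters.  Write z = (a + b y) / c.  Unless c or
    a + b y is nonzero at the point P, either x - al divides a, b and c and can be
    cancelled; or P is a branch point and y is used as parameter; or the
    conjugate a - b y is nonzero at P, and multiplying by it replaces the
    numerator by the norm a^2 - b^2 f, which is divisible by x - al.  In the first
    and the last case the degree of c drops; at a branch point 1/z is regular. *)
Lemma local_ring_total_rec n (a b c : {poly F}) z : (size c <= n)%N -> c != 0 ->
  z * E c = E a + E b * y -> O z \/ O z^-1.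
Proof.
elim: n a b c z => [|n IHn] a b c z szc nzc zE.
  by move: szc; rewrite leqNgt size_poly_gt0 nzc.
have zV : z * V c%:P = V (a%:P + b%:P * 'X) by rewrite bvalC bval_line.
have [c0|nzc0] := eqVneq c.[al] 0; last first.
  by left; apply: local_ring_frac zV _; rewrite bvalC.
have [ab0|nzab] := eqVneq (a.[al] + b.[al] * be) 0; last first.
  by right; apply: local_ring_frac_inv zV _; rewrite ev_line.
have [c1 def_c] := zero_factor c0.
rewrite {}def_c in szc nzc zE.
have [szc1 nzc1] := size_cofactor szc nzc.
have both0 : a.[al] = 0 -> b.[al] = 0 -> O z \/ O z^-1.
  move=> /zero_factor[a1 def_a] /zero_factor[b1 def_b].
  by apply: (IHn a1 b1 c1) => //; apply: cancel_XsubC; rewrite -def_a -def_b.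
have [be0|nzbe] := eqVneq be 0.
  have a0 : a.[al] = 0 by rewrite be0 mulr0 addr0 in ab0.
  have [b0|nzb] := eqVneq b.[al] 0; first exact: both0.
  have [f1 def_f] : exists f1, f = f1 * ('X - al%:P).
    by apply: zero_factor; rewrite -pt be0 expr0n.
  have [a1 def_a] := zero_factor a0; rewrite def_a in zE.
  right; apply: local_ring_frac_inv (ramified_frac be0 def_f zE) _.
  by rewrite ev_line hornerM (ramified_cofactor def_f) be0 mulr1 mulr0 addr0.
have [ab1|nzab1] := eqVneq (a.[al] - b.[al] * be) 0.
  have a0 := eq0_of_conj nz2 ab0 ab1.
  apply: both0 => //; apply/eqP; move/eqP: ab0.
  by rewrite a0 add0r mulf_eq0 (negPf nzbe) orbF.
pose N := a ^+ 2 - b ^+ 2 * f; pose conj := a%:P + (- b)%:P * 'X.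
have nzconj : ev conj != 0 by rewrite ev_line hornerN mulNr.
have zN : z * V conj * E (c1 * ('X - al%:P)) = E N.
  by rewrite mulrAC zE /conj bval_line /N rmorphB !rmorphM -model_sqr; ring.
have [N1 def_N] : exists N1, N = N1 * ('X - al%:P).
  apply: zero_factor; rewrite !hornerE -pt.
  transitivity ((a.[al] + b.[al] * be) * (a.[al] - b.[al] * be)); first ring.
  by rewrite ab0 mul0r.
have zN1 : z * V conj * E c1 = E N1 + E 0 * y.
  apply: cancel_XsubC; rewrite zN def_N mul0r rmorph0 mul0r addr0 //.
have [zO|zO] := IHn _ _ _ _ szc1 nzc1 zN1.
  left; rewrite -[z](mulfK (bval_neq0 nzconj)).
  by apply: local_ringM zO _; apply: local_ringV.
right; rewrite -[z](mulfK (bval_neq0 nzconj)) invf_div.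
by apply: local_ringM zO; apply: local_ring_bval.
Qed.

Lemma local_ring_place : is_place iota O.
Proof.
split=> [|u v Ou Ov|u _|]; first exact: local_ring_const.
- by split; [apply: local_ringB | apply: local_ringM].
- have [_ _ gen] := mod_xy; have [a [b [c [nzc uE]]]] := gen u.
  exact: local_ring_total_rec (leqnn _) nzc uE.
(* 1 / (x - al) has a pole at the point *)
exists (E ('X - al%:P))^-1 => -[A [B [/eqP nzB]]].
move/(canRL (mulKf (invr_neq0 XsubC_pval_neq0))); rewrite invrK => VB; case: nzB.
have: V (B - ('X - al%:P)%:P * A) = 0.
  by rewrite rmorphB rmorphM bvalC VB subrr.
move/(specialize pt); rewrite rmorphB rmorphM bvalC /= /horner_eval.
by rewrite hornerXsubC subrr mul0r subr0.
Qed.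

End Point.

Hypotheses (nz2 : 2 != 0 :> F) (df : f^`() = 1).

(** Induction on the degree of the denominator c.  At a root al of c, regularity
    at the two points (al, be) and (al, - be) makes a + b y vanish at both, hence
    a and b vanish at al and x - al cancels.  If be = 0 the two points coincide,
    and the second condition comes from multiplying by y. *)
Lemma regular_pval_line_rec n (a b c : {poly F}) z : (size c <= n)%N -> c != 0 ->
    (forall al be, be ^+ 2 = f.[al] -> local_ring al be z) ->
    z * E c = E a + E b * y ->
  exists a b, z = E a + E b * y.
Proof.
move=> szc nzc Oz; elim: n a b c szc nzc => [|n IHn] a b c szc nzc zE.
  by move: szc; rewrite leqNgt size_poly_gt0 nzc.
have [/eqP/size_poly1P[c0 nzc0 def_c]|] := eqVneq (size c) 1%N.
  exists (c0^-1 *: a), (c0^-1 *: b).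
  have nzi : iota c0 != 0 by rewrite fmorph_eq0.
  apply: (mulIf nzi); move: zE; rewrite def_c pvalC => ->.
  by rewrite -!mul_polyC !rmorphM !pvalC fmorphV; field.
move=> /closed_rootP[al /rootP c0].
have [be /rootP] : exists be, root ('X^2 - (f.[al])%:P) be.
  by apply/closed_rootP; rewrite size_XnsubC.
rewrite !hornerE => /eqP; rewrite subr_eq0 => /eqP pt.
have [c1 def_c] := zero_factor c0.
have num0 b1 : b1 ^+ 2 = f.[al] -> a.[al] + b.[al] * b1 = 0.
  move=> pt1; have [A [B [nzB zB]]] := Oz _ _ pt1.
  have : V ((a%:P + b%:P * 'X) * B - c%:P * A) = 0.
    by rewrite rmorphB !rmorphM bval_line bvalC -zE -zB; ring.
  move/(specialize pt1); rewrite rmorphB !rmorphM ev_line bvalC /= /horner_eval.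
  by rewrite c0 mul0r subr0 => /eqP; rewrite mulf_eq0 (negPf nzB) orbF => /eqP.
have ab0 := num0 _ pt; have ab1 := num0 (- be); rewrite sqrrN mulrN in ab1.
have a0 := eq0_of_conj nz2 ab0 (ab1 pt).
have [a1 def_a] := zero_factor a0.
rewrite {}def_c {}def_a {c c0 a a0 num0 ab1} in szc nzc zE ab0.
have [szc1 nzc1] := size_cofactor szc nzc.
have b0 : b.[al] = 0.
  have [be0|nzbe] := eqVneq be 0; last first.
    move/eqP: ab0; rewrite hornerM hornerXsubC subrr mulr0 add0r mulf_eq0.
    by rewrite (negPf nzbe) orbF => /eqP.
  have [f1 def_f] : exists f1, f = f1 * ('X - al%:P).
    by apply: zero_factor; rewrite -pt be0 expr0n.
  subst be.
  have zV := ramified_frac (erefl 0) def_f zE.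
  have [A [B [nzB zB]]] := Oz _ _ pt.
  have: V ((((b * f1)%:P + a1%:P * 'X) * B - c1%:P * 'X * A)) = 0.
    by rewrite rmorphB (rmorphM _ _ B) -zV !rmorphM -zB; ring.
  move/(specialize pt); rewrite rmorphB (rmorphM _ _ B) ev_line !rmorphM bvalX.
  rewrite !(mulr0, mul0r) addr0 subr0 => /eqP.
  by rewrite hornerM (ramified_cofactor df def_f) mulr1 mulf_eq0 (negPf nzB) orbF => /eqP.
have [b1 def_b] := zero_factor b0.
by apply: (IHn a1 b1 c1) => //; apply: (@cancel_XsubC al); rewrite -def_b.
Qed.

Lemma regular_pval_line z :
    (forall al be, be ^+ 2 = f.[al] -> local_ring al be z) ->
  exists a b, z = E a + E b * y.
Proof.
move=> Oz; have [_ _ gen] := mod_xy; have [a [b [c [nzc zE]]]] := gen z.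
exact: regular_pval_line_rec (leqnn _) nzc Oz zE.
Qed.

End Model.

(** * Derivations and regular differentials *)

Section Derivation.
Context (F K : fieldType) (iota : {rmorphism F -> K}).
Context (M : lmodType K) (D : K -> M).
Hypothesis derD : is_derivation iota D.

Lemma derivation0 : D 0 = 0.
Proof. by have [_ _ Dc] := derD; rewrite -[RHS](Dc 0) rmorph0. Qed.

Lemma derivation_sum (I : Type) (r : seq I) (P : pred I) (G : I -> K) :
  D (\sum_(i <- r | P i) G i) = \sum_(i <- r | P i) D (G i).
Proof. by have [Da _ _] := derD; exact: (big_morph D Da derivation0). Qed.

Lemma derivation_exp u n : D (u ^+ n) = (n%:R * u ^+ n.-1) *: D u.
Proof.
have [_ Dm Dc] := derD; elim: n => [|n IHn].
  by rewrite expr0 mul0r scale0r -(rmorph1 iota) Dc.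
rewrite exprS Dm IHn scalerA -scalerDl; congr (_ *: _).
by case: n {IHn} => [|n] /=; rewrite ?exprS; ring.
Qed.

Lemma derivation_horner (q : {poly K}) u : (forall i, D q`_i = 0) ->
  D q.[u] = q^`().[u] *: D u.
Proof.
have [Da Dm _] := derD.
elim/poly_ind: q => [_|q c IHq Dq]; first by rewrite deriv0 !horner0 derivation0 scale0r.
have Dc : D c = 0 by have := Dq 0; rewrite coefD coefMX coefC /= add0r.
rewrite derivD derivM derivX derivC addr0 mulr1 !hornerE Da Dm Dc addr0.
rewrite IHq => [|i]; last by have := Dq i.+1; rewrite coefD coefMX coefC addr0.
by rewrite scalerA -scalerDl; congr (_ *: _); ring.
Qed.

Lemma derivation_pval x a : D (pval iota x a) = pval iota x a^`() *: D x.
Proof.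
rewrite -pvalE derivation_horner => [|i]; last first.
  by have [_ _ Dc] := derD; rewrite coef_map Dc.
by rewrite deriv_map.
Qed.

End Derivation.

Section ModelDerivation.
Context (F : closedFieldType) (K : fieldType) (iota : {rmorphism F -> K}).
Context (f : {poly F}) (x y : K) (D : K -> K^o).
Hypotheses (nz2 : 2 != 0 :> F) (oddf : odd (size f).-1) (df : f^`() = 1).
Hypotheses (mod_xy : model iota f x y) (derD : is_derivation iota D).
Local Notation E := (pval iota x).
Local Notation V := (bval (pval iota x) y).

Lemma derivation_ordinate : (D x : K) = 2 * y * D y.
Proof.
have := derivation_exp derD y 2; rewrite (model_sqr mod_xy).
by rewrite (derivation_pval derD) df rmorph1 scale1r.
Qed.

(** Differentiating y^2 = f(x) gives 2 y dy = dx, so y clears the denominator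
    that dy brings in. *)
Lemma derivation_bval A : exists B, y * D (V A) = V B * D x.
Proof.
have [Da Dm _] := derD; have [a [b [Q ->]]] := bivariate_red f A.
rewrite bval_red; last exact: model_sqr mod_xy.
exists ((b * (2^-1)%:P + f * b^`())%:P + a^`()%:P * 'X).
rewrite bval_line Da Dm !(derivation_pval derD) !rmorphD !rmorphM pvalC fmorphV.
have nz2K : 2 != 0 :> K by rewrite -(rmorph_nat iota) fmorph_eq0.
rewrite rmorph_nat -(model_sqr mod_xy) derivation_ordinate.
rewrite -[_ *: _]/(_ * _) -[E b *: _]/(_ * _)
  -[y *: _]/(_ * _) -[E b^`() *: _]/(_ * _).
by field.
Qed.

Lemma local_ring_derivation al be h : be ^+ 2 = f.[al] ->
  local_ring iota x y al be h ->
  exists t, local_ring iota x y al be t /\ y * D h = t * D x.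
Proof.
move=> pt Oh; have [A [B [nzB hB]]] := Oh.
have nzVB := bval_neq0 oddf mod_xy pt nzB.
have [QA DA] := derivation_bval A; have [QB DB] := derivation_bval B.
exists ((V QA - h * V QB) * (V B)^-1); split.
  apply: local_ringM; last exact: (local_ringV oddf mod_xy pt nzB).
  by apply: local_ringB; [| apply: local_ringM] => //; apply: local_ring_bval.
have [_ Dm _] := derD; move: (congr1 D hB); rewrite Dm => Dh.
apply: (mulIf nzVB).
transitivity (y * D (V A) - h * (y * D (V B))).
  by rewrite -Dh -[h *: _]/(_ * _) -[V B *: _]/(_ * _); ring.
by rewrite DA DB; field.
Qed.

(** At an affine point P, y D h is an element of the local ring times D x for
    each h in that ring, so a differential v regular at P has y v / D x regular
    at P. *)
Lemma holomorphic_line v : holomorphic iota D v -> D x != 0 ->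
  exists a b, y * v = (E a + E b * y) * D x.
Proof.
move=> hol nzDx.
have [al be pt|a [b vE]] := regular_pval_line (z := y * v / D x) oddf mod_xy nz2 df.
  have [n [g [h [Ogh ->]]]] := hol _ (local_ring_place oddf mod_xy pt nz2 df).
  suff [t [Ot ->]]: exists t, local_ring iota x y al be t /\
      y * (\sum_(i < n) g i *: D (h i)) = t * D x by rewrite mulfK.
  elim/big_rec: _ => [|i u _ [t [Ot uE]]].
    exists 0; rewrite mulr0 mul0r; split=> //.
    by rewrite -(rmorph0 V); apply: local_ring_bval.
  have [Og Oh] := Ogh i; have [s [Os hE]] := local_ring_derivation pt Oh.
  exists (g i * s + t); split.
    by apply: local_ringD Ot; apply: local_ringM Og Os.
  by rewrite mulrDr uE mulrCA hE; ring.
exists a, b; rewrite -vE divfK //.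
Qed.

(** Valuation rings are integrally closed. *)
Lemma place_sqr O u : is_place iota O -> O (u ^+ 2) -> O u.
Proof.
move=> [_ Oring Ototal _] Ou2; have [->|nzu] := eqVneq u 0.
  by have [] := Oring _ _ Ou2 Ou2; rewrite subrr.
have [//|OV] := Ototal u nzu; have [_] := Oring _ _ Ou2 OV.
by rewrite expr2 mulfK.
Qed.

Lemma place_pval O a : is_place iota O -> O x -> O (E a).
Proof.
move=> plO Ox; have [Oc Oring _ _] := plO.
have OD u v : O u -> O v -> O (u + v).
  move=> Ou Ov; have [O0 _] := Oring _ _ Ov Ov; rewrite subrr in O0.
  have [ONv _] := Oring _ _ O0 Ov; rewrite sub0r in ONv.
  by have [] := Oring _ _ Ou ONv; rewrite opprK.
elim/poly_ind: a => [|a c IHa]; first by rewrite rmorph0 -(rmorph0 iota).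
rewrite rmorphD rmorphM pvalX pvalC; apply: OD => //.
by have [] := Oring _ _ IHa Ox.
Qed.

(** Here a(x) dx / y = 2 a(x) dy, and x regular makes y regular. *)
Lemma regular_finite O a : is_place iota O -> O x ->
  regular_at D O (E a / y * D x).
Proof.
move=> plO Ox; exists 1%N, (fun=> E (2 * a)), (fun=> y); split.
  move=> _; split; first exact: place_pval.
  by apply: (place_sqr plO); rewrite (model_sqr mod_xy); apply: place_pval.
rewrite big_ord1 derivation_ordinate rmorphM rmorph_nat -[_ *: _]/(_ * _).
have nzy := model_ordinate_neq0 oddf mod_xy.
by field.
Qed.

End ModelDerivation.

(** * The point at infinity *)

(** X^n c(1/X); the bound n may exceed the degree of c, which allows a common
    power of X for several polynomials. *)
Definition rev_poly (R : nzRingType) n (c : {poly R}) : {poly R} :=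
  \poly_(i < n.+1) c`_(n - i).

Lemma pval_rev (F K : fieldType) (iota : {rmorphism F -> K}) x n (c : {poly F}) :
    x != 0 -> (size c <= n.+1)%N ->
  pval iota x (rev_poly n c) = x ^+ n * pval iota x^-1 c.
Proof.
move=> nzx szc; rewrite -!pvalE.
have szc' : (size (map_poly iota c) <= n.+1)%N.
  exact: leq_trans (size_poly _ _) szc.
rewrite (horner_coef_wide _ szc') (@horner_coef_wide _ n.+1); last first.
  by apply: leq_trans (size_poly _ _) (size_poly _ _).
rewrite mulr_sumr (reindex_inj rev_ord_inj) /=; apply: eq_bigr => i _.
have lein : (i <= n)%N by rewrite -ltnS.
rewrite !coef_map /= coef_poly subSS ltnS leq_subr subKn //.
rewrite mulrCA exprVn; congr (_ * _); apply: (mulIf (expf_neq0 i nzx)).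
by rewrite mulfVK ?expf_neq0 // -exprD subnK.
Qed.

Lemma rev_poly_neq0 (R : nzRingType) n (c : {poly R}) :
  (size c <= n.+1)%N -> c != 0 -> rev_poly n c != 0.
Proof.
move=> szc; apply: contraNneq => rev0; apply/eqP/polyP=> i; rewrite coef0.
have [lein|ltni] := leqP i n; last exact: nth_default (leq_trans szc ltni).
have := congr1 (fun q : {poly R} => q`_(n - i)) rev0.
by rewrite coef0 coef_poly ltnS leq_subr subKn.
Qed.

Lemma odd_size_curve (R : nzRingType) m : (1 < m)%N -> odd m ->
  odd (size ('X^m + 'X : {poly R})).-1.
Proof.
by move=> m_gt1; rewrite size_polyDl ?size_polyXn // size_polyX ltnS.
Qed.

Lemma deriv_curve (R : nzRingType) m : m%:R = 0 :> R ->
  ('X^m + 'X : {poly R})^`() = 1.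
Proof.
by move=> m0; rewrite derivD derivXn derivX -mulr_natr -polyC_natr m0 mulr0 add0r.
Qed.

Section Infinity.
Context (F : closedFieldType) (K : fieldType) (iota : {rmorphism F -> K}).
Context (g m : nat) (x y : K) (f := 'X^m + 'X : {poly F}).
Hypotheses (def_m : m = (2 * g).+1) (mod_xy : model iota f x y).

Lemma model_absc_neq0 : x != 0.
Proof. by rewrite -(pvalX iota x) (pval_eq0 mod_xy) polyX_eq0. Qed.

(** Dividing y^2 = x^m + x by x^(m+1) gives (y / x^(g+1))^2 = 1/x + 1/x^m: the
    equation is preserved, and the point at infinity goes to the origin. *)
Lemma model_inv : model iota f x^-1 (y * x^-1 ^+ g.+1).
Proof.
have nzx := model_absc_neq0; have nzx' : x^-1 != 0 by rewrite invr_eq0.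
have [tr y2 gen] := mod_xy.
have revK n (c : {poly F}) : (size c <= n.+1)%N ->
    pval iota x^-1 (rev_poly n c) = x^-1 ^+ n * pval iota x c.
  by move=> szc; rewrite pval_rev // invrK.
split=> [a nza||z].
- have := tr _ (rev_poly_neq0 (leqnSn (size a)) nza).
  by rewrite pval_rev ?leqnSn // mulf_eq0 negb_or => /andP[].
- rewrite exprMn y2 /f !rmorphD !rmorphXn !pvalX -exprM.
  have -> : (g.+1 * 2 = m + 1)%N by rewrite def_m; lia.
  rewrite exprD mulrDl expr1 !exprVn; field.
  by rewrite nzx expf_neq0.
have [a [b [c [nzc zE]]]] := gen z.
pose n := (size a + size b + size c)%N.
exists (rev_poly n a * 'X^(g.+1)), (rev_poly n b), (rev_poly n c * 'X^(g.+1)).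
have [sza szb szc] : [/\ size a <= n.+1, size b <= n.+1 & size c <= n.+1]%N.
  by rewrite /n; split; lia.
split; first by rewrite mulf_neq0 ?expf_neq0 ?polyX_eq0 // rev_poly_neq0.
rewrite !rmorphM !rmorphXn !pvalX !revK //.
by rewrite mulrA mulrCA zE; ring.
Qed.

Context (D : K -> K^o).
Hypotheses (nz2 : 2 != 0 :> F) (m0 : m%:R = 0 :> F) (g_gt0 : (0 < g)%N).
Hypotheses (derD : is_derivation iota D) (Dx : (D x : K) = 1).
Local Notation E := (pval iota x).

Let oddf : odd (size f).-1.
Proof. by apply: odd_size_curve; rewrite def_m ?ltnS ?muln_gt0 //= mul2n odd_double. Qed.

Let df : f^`() = 1 := deriv_curve m0.

Lemma derivation_inv : (D x^-1 : K) = - x^-1 ^+ 2.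
Proof.
have nzx := model_absc_neq0; have [_ Dm Dc] := derD.
have := Dm x x^-1; rewrite mulfV // -(rmorph1 iota) Dc.
rewrite -[x *: _]/(_ * _) -[_ *: D x]/(_ * _) Dx mulr1 => /esym/eqP.
rewrite addr_eq0 => /eqP xD; apply: (mulfI nzx); rewrite xD; by field.
Qed.

(** For v dx holomorphic, y v = a(x) + b(x) y from the first model, while the
    second gives x^2 (a(x) + b(x) y) = - x^(g+1) c(1/x) - e(1/x) y.  Comparing
    degrees, b = 0 and deg a < g. *)
Lemma holomorphic_numerator v : holomorphic iota D v ->
  exists2 a : {poly F}, (size a <= g)%N & v = E a / y.
Proof.
move=> hol; have nzx := model_absc_neq0.
have [|a [b vE]] := holomorphic_line nz2 oddf df mod_xy derD hol.
  by rewrite Dx oner_eq0.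
have [|c [e vE']] := holomorphic_line nz2 oddf df model_inv derD hol.
  by rewrite derivation_inv oppr_eq0 expf_neq0 // invr_eq0.
rewrite derivation_inv in vE'; rewrite Dx mulr1 in vE.
have key : (E a + E b * y) * x ^+ 2
    = - (pval iota x^-1 c * x ^+ g.+1 + pval iota x^-1 e * y).
  transitivity (y * x^-1 ^+ g.+1 * v * x ^+ g.+3).
    by rewrite -vE exprVn !exprS; field; rewrite nzx expf_neq0.
  by rewrite vE' !exprVn !exprS; field; rewrite nzx expf_neq0.
(* multiplying by x ^ n turns c(1/x) and e(1/x) into polynomials in x *)
pose n := (size c + size e)%N.
have [szc sze] : (size c <= n.+3 /\ size e <= n.+1)%N by rewrite /n; split; lia.
have : E (a * 'X^(n.+2) + rev_poly n.+2 c * 'X^(g.-1))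
        + E (b * 'X^(n.+2) + rev_poly n e) * y = 0.
  rewrite !rmorphD (rmorphM _ a) (rmorphM _ (rev_poly _ _)) (rmorphM _ b).
  rewrite !pvalXn !pval_rev //.
  transitivity (x ^+ n * ((E a + E b * y) * x ^+ 2
    + (pval iota x^-1 c * x ^+ g.+1 + pval iota x^-1 e * y))).
    by case: (g) g_gt0 => // g' _; rewrite succnK !exprS; ring.
  by rewrite key addNr mulr0.
move/(split_eq0 oddf mod_xy) => [/eqP a0 /eqP b0].
have b_eq0 : b = 0.
  apply/eqP; apply: contraTT isT => nzb.
  move: b0; rewrite addr_eq0 => /eqP/(congr1 (size \o polyseq)) /=.
  rewrite size_polyN size_Mmonic ?monicXn // size_polyXn => sz_eq.
  have := size_poly n.+1 (fun i => e`_(n - i)); rewrite -/(rev_poly n e) -sz_eq.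
  by move: nzb; rewrite -size_poly_gt0; lia.
exists a; last first.
  apply: (canRL (mulfK (model_ordinate_neq0 oddf mod_xy))).
  by rewrite mulrC vE b_eq0 rmorph0 mul0r addr0.
have [->|nza] := eqVneq a 0; first by rewrite size_poly0.
move: a0; rewrite addr_eq0 => /eqP/(congr1 (size \o polyseq)) /=.
rewrite size_polyN size_Mmonic ?monicXn // size_polyXn => sz_eq.
have := size_polyMleq (rev_poly n.+2 c) 'X^(g.-1).
have := size_poly n.+3 (fun i => c`_(n.+2 - i)); rewrite -/(rev_poly n.+2 c).
rewrite -sz_eq size_polyXn; move: (size _) (size _) g_gt0 => r q; lia.
Qed.

(** At a place where x is not regular, 1/x is, and the differential has the same
    shape in the second model, with numerator - x^(1-g) a(x). *)
Lemma holomorphic_pval (a : {poly F}) : (size a <= g)%N -> holomorphic iota D (E a / y).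
Proof.
move=> sza O plO; have [_ _ Ototal _] := plO; have nzx := model_absc_neq0.
have [Ox|Oxi] := Ototal x nzx.
  have := regular_finite oddf df mod_xy derD a plO Ox.
  by rewrite Dx mulr1.
have := regular_finite oddf df model_inv derD (- rev_poly g.-1 a) plO Oxi.
rewrite derivation_inv rmorphN pval_rev ?invr_eq0 ?prednK // invrK.
congr (regular_at D O _).
have nzy := model_ordinate_neq0 oddf mod_xy.
case: (g) g_gt0 => // g' _; rewrite succnK !exprVn !exprS; field.
by rewrite nzx nzy expf_neq0.
Qed.
End Infinity.

(** * The derivation d/dx of the function field *)

Section CoordinateDerivation.
Context (F : closedFieldType) (K : fieldType) (iota : {rmorphism F -> K}).
Context (f : {poly F}) (x y : K).
Hypotheses (oddf : odd (size f).-1) (mod_xy : model iota f x y).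
Hypotheses (nz2 : 2 != 0 :> F) (df : f^`() = 1).
Local Notation E := (pval iota x).

Let nzy : y != 0 := model_ordinate_neq0 oddf mod_xy.

Let nz2K : 2 != 0 :> K.
Proof. by rewrite -(rmorph_nat iota) fmorph_eq0. Qed.

(** The derivative of a(x) + b(x) y, as y' = 1 / (2 y). *)
Definition line_der (a b : {poly F}) : K := E a^`() + E b^`() * y + E b / (2 * y).

Lemma line_derM a b a1 b1 :
  line_der (a * a1 + b * b1 * f) (a * b1 + b * a1) =
  line_der a b * (E a1 + E b1 * y) + (E a + E b * y) * line_der a1 b1.
Proof.
rewrite /line_der !(derivD, derivM) df !(rmorphD, rmorphM) rmorph1.
rewrite -(model_sqr mod_xy); field.
by rewrite nz2K nzy.
Qed.

Lemma line_derD a b a1 b1 :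
  line_der (a + a1) (b + b1) = line_der a b + line_der a1 b1.
Proof. by rewrite /line_der !derivD !rmorphD; field; rewrite nz2K nzy. Qed.

Lemma line_der_poly c : line_der c 0 = E c^`().
Proof. by rewrite /line_der deriv0 rmorph0 !mul0r !addr0. Qed.

Lemma line_der_scale a b c :
  line_der (a * c) (b * c) = line_der a b * E c + (E a + E b * y) * E c^`().
Proof.
have := line_derM a b c 0; rewrite !mulr0 mul0r add0r addr0 => ->.
by rewrite line_der_poly rmorph0 mul0r addr0.
Qed.

Definition fraction_of (u : K) (r : {poly F} * {poly F} * {poly F}) : bool :=
  (r.2 != 0) && (u * E r.2 == E r.1.1 + E r.1.2 * y).

Lemma fraction_ofP u : exists r, fraction_of u r.
Proof.
have [_ _ gen] := mod_xy; have [a [b [c [nzc uE]]]] := gen u.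
by exists (a, b, c); rewrite /fraction_of /= nzc uE eqxx.
Qed.

(** The quotient rule, applied to one chosen fraction; the next lemma shows that
    the choice is irrelevant. *)
Definition coord_der (u : K) : K^o :=
  let r := xchoose (fraction_ofP u) in
  (line_der r.1.1 r.1.2 - u * E r.2^`()) / E r.2.

(** Two fractions for u differ by a factor in numerator and denominator, and
    differentiating that proportion gives the independence.  The quotient rule is
    stated without division, so that sums and products of fractions follow from
    it by ring identities. *)
Lemma coord_der_fraction u a b c : c != 0 -> u * E c = E a + E b * y ->
  coord_der u * E c + u * E c^`() = line_der a b.
Proof.
move=> nzc uE; rewrite /coord_der.
have := xchooseP (fraction_ofP u).
case: (xchoose _) => [[a1 b1] c1] /andP[/= nzc1 /eqP u1E].
have nzEc : E c != 0 by rewrite (pval_eq0 mod_xy).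
have nzEc1 : E c1 != 0 by rewrite (pval_eq0 mod_xy).
have [eq_a eq_b] : a * c1 - a1 * c = 0 /\ b * c1 - b1 * c = 0.
  apply: (split_eq0 oddf mod_xy); rewrite !rmorphB !rmorphM.
  transitivity ((E a + E b * y) * E c1 - (E a1 + E b1 * y) * E c); first by ring.
  by rewrite -uE -u1E; ring.
have := congr2 line_der (subr0_eq eq_a) (subr0_eq eq_b).
rewrite !line_der_scale -uE -u1E => eq_der.
apply: (mulIf nzEc1); transitivity (line_der a1 b1 * E c + u * E c1 * E c^`()
  - u * E c * E c1^`()); first by field.
by rewrite -eq_der; ring.
Qed.

Lemma coord_der_derivation : is_derivation iota coord_der.
Proof.
split=> [u v|u v|c].
- have [r /andP[nzc /eqP uE]] := fraction_ofP u.
  have [q /andP[nzd /eqP vE]] := fraction_ofP v.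
  case: r q nzc uE nzd vE => [[a b] c] [[a1 b1] d] /= nzc uE nzd vE.
  have Du := coord_der_fraction nzc uE; have Dv := coord_der_fraction nzd vE.
  have nzcd : c * d != 0 by rewrite mulf_neq0.
  have uvE : (u + v) * E (c * d)
      = E (a * d + a1 * c) + E (b * d + b1 * c) * y.
    rewrite rmorphM; transitivity (u * E c * E d + v * E d * E c); first by ring.
    by rewrite uE vE !rmorphD !rmorphM; ring.
  have := coord_der_fraction nzcd uvE.
  rewrite line_derD !line_der_scale -Du -Dv -uE -vE derivM rmorphD !rmorphM.
  move=> Duv; have : E c * E d != 0 by rewrite -rmorphM (pval_eq0 mod_xy).
  move/mulIf; apply.
  by apply: (addIr ((u + v) * (E c^`() * E d + E c * E d^`()))); rewrite Duv; ring.
- have [r /andP[nzc /eqP uE]] := fraction_ofP u.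
  have [q /andP[nzd /eqP vE]] := fraction_ofP v.
  case: r q nzc uE nzd vE => [[a b] c] [[a1 b1] d] /= nzc uE nzd vE.
  have Du := coord_der_fraction nzc uE; have Dv := coord_der_fraction nzd vE.
  have nzcd : c * d != 0 by rewrite mulf_neq0.
  have uvE : u * v * E (c * d)
      = E (a * a1 + b * b1 * f) + E (a * b1 + b * a1) * y.
    rewrite rmorphM; transitivity ((u * E c) * (v * E d)); first by ring.
    by rewrite uE vE !(rmorphD, rmorphM) -(model_sqr mod_xy); ring.
  have := coord_der_fraction nzcd uvE.
  rewrite line_derM -Du -Dv -uE -vE derivM rmorphD !rmorphM => Duv.
  have : E c * E d != 0 by rewrite -rmorphM (pval_eq0 mod_xy).
  move/mulIf; apply; rewrite -[u *: _]/(_ * _) -[v *: _]/(_ * _).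
  by apply: (addIr (u * v * (E c^`() * E d + E c * E d^`()))); rewrite Duv; ring.
have oneE : iota c * E 1 = E c%:P + E 0 * y.
  by rewrite rmorph1 rmorph0 pvalC mul0r mulr1 addr0.
have := coord_der_fraction (oner_neq0 _) oneE.
by rewrite line_der_poly !derivC !rmorph0 mulr0 addr0 rmorph1 mulr1.
Qed.

Lemma coord_der_absc : (coord_der x : K) = 1.
Proof.
have xE : x * E 1 = E 'X + E 0 * y.
  by rewrite rmorph1 rmorph0 pvalX mul0r mulr1 addr0.
have := coord_der_fraction (oner_neq0 _) xE.
by rewrite line_der_poly derivC derivX rmorph0 mulr0 addr0 !rmorph1 mulr1.
Qed.

End CoordinateDerivation.

(** * The basis 1, x, ..., x^(p-1) over the p-th powers *)

Section LineThrough.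
Context (K : fieldType) (M : lmodType K) (v : M).
Definition line_through (c : K^o) : M := c *: v.
Lemma line_through_linear : linear line_through.
Proof. by move=> a u w; rewrite /line_through scalerDl scalerA. Qed.
HB.instance Definition _ :=
  GRing.isLinear.Build K K^o M *:%R line_through line_through_linear.
End LineThrough.

Lemma odd_prime_half p : prime p -> (2 < p)%N -> p = (2 * p./2).+1.
Proof. by move=> p_pr p_gt2; have [] := even_prime p_pr; lia. Qed.

Section PBasis.
Context (F : closedFieldType) (K : fieldType) (iota : {rmorphism F -> K}).
Context (f : {poly F}) (x y : K) (p : nat).
Hypotheses (charFp : p \in [pchar F]) (p_gt2 : (2 < p)%N).
Hypothesis (mod_xy : model iota f x y).

Let charKp : p \in [pchar K] := rmorph_pchar iota charFp.
Let frob : {rmorphism K -> K} := pFrobenius_aut charKp.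
Local Notation E := (pval iota x).

Lemma char_prime : prime p. Proof. exact: pcharf_prime charFp. Qed.

Let p_gt0 : (0 < p)%N := prime_gt0 char_prime.

(** The value at x of the polynomial whose coefficients are the p-th powers of
    those of Q; the image is the subring K^p[x]. *)
Definition frob_val (Q : {poly K}) : K := (map_poly frob Q).[x].

Lemma frob_valD P Q : frob_val (P + Q) = frob_val P + frob_val Q.
Proof. by rewrite /frob_val rmorphD hornerD. Qed.

Lemma frob_valM P Q : frob_val (P * Q) = frob_val P * frob_val Q.
Proof. by rewrite /frob_val rmorphM hornerM. Qed.

Lemma frob_valC c : frob_val c%:P = c ^+ p.
Proof. by rewrite /frob_val map_polyC hornerC /= pFrobenius_autE. Qed.

Lemma frob_valX : frob_val 'X = x.
Proof. by rewrite /frob_val map_polyX hornerX. Qed.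

Lemma const_pth_root (c : F) : exists b, c = b ^+ p.
Proof.
have [|b] := (closed_rootP ('X^p - c%:P) _).
  by rewrite size_XnsubC // eqSS -lt0n.
by rewrite /root !hornerE subr_eq0 => /eqP <-; exists b.
Qed.

Lemma frob_val_pval a : exists Q, E a = frob_val Q.
Proof.
elim/poly_ind: a => [|a c [Q aE]].
  by exists 0; rewrite rmorph0 /frob_val rmorph0 horner0.
have [b cE] := const_pth_root c; exists (Q * 'X + (iota b)%:P).
by rewrite frob_valD frob_valM frob_valC frob_valX rmorphD rmorphM pvalX pvalC
           cE rmorphXn aE.
Qed.

(** 1/u = (1/u)^p u^(p-1): a ring between K^p and K is a field. *)
Lemma frob_valV Q : exists P, (frob_val Q)^-1 = frob_val P.
Proof.
have [Q0|nzQ] := eqVneq (frob_val Q) 0.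
  by exists Q; rewrite Q0 invr0.
exists (((frob_val Q)^-1)%:P * Q ^+ p.-1).
have -> : frob_val (((frob_val Q)^-1)%:P * Q ^+ p.-1)
    = (frob_val Q)^-1 ^+ p * frob_val Q ^+ p.-1.
  by rewrite frob_valM frob_valC /frob_val rmorphXn horner_exp.
rewrite -[in RHS](prednK p_gt0) exprS -mulrA -exprMn mulVf //.
by rewrite expr1n mulr1.
Qed.

Let p_half : p = (2 * p./2).+1 := odd_prime_half char_prime p_gt2.

(** K^p[x] is a field containing F, because F is perfect, and x.  It contains y
    because y = y^p / (y^2)^h with y^2 = f(x).  Hence it is K. *)
Lemma frob_val_surj u : exists2 Q : {poly K}, (size Q <= p)%N & u = frob_val Q.
Proof.
suff [Q ->] : exists Q, u = frob_val Q.
  (* x is a root of T^p - x^p, the Frobenius image of T^p - x *)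
  exists (Q %% ('X^p - x%:P)).
    by rewrite -ltnS -(size_XnsubC x p_gt0) ltn_modp -size_poly_gt0 size_XnsubC.
  rewrite [in LHS](divp_eq Q ('X^p - x%:P)) frob_valD frob_valM.
  rewrite [X in _ * X]/frob_val rmorphB rmorphXn /= map_polyX map_polyC !hornerE /=.
  by rewrite pFrobenius_autE subrr mulr0 add0r.
have [_ y2 gen] := mod_xy; have [a [b [c [nzc uE]]]] := gen u.
have [Qa aE] := frob_val_pval a; have [Qb bE] := frob_val_pval b.
have [Qc cE] := frob_val_pval c; have [Qi iE] := frob_valV Qc.
have [Qf fE] := frob_val_pval f.
have [Qy yE] : exists Q, y = frob_val Q.
  have [Qg gE] := frob_valV (Qf ^+ p./2).
  exists (y%:P * Qg); rewrite frob_valM frob_valC -gE.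
  have [y0|nzy] := eqVneq y 0; first by rewrite y0 expr0n -[p]prednK //= mul0r.
  have -> : frob_val (Qf ^+ p./2) = y ^+ (2 * p./2).
    by rewrite exprM y2 fE /frob_val rmorphXn horner_exp.
  by rewrite [in y ^+ p]p_half exprSr mulrAC mulfV ?mul1r ?expf_neq0.
exists ((Qa + Qb * Qy) * Qi).
rewrite frob_valM frob_valD frob_valM -iE -yE -aE -bE -cE -uE mulfK //.
by rewrite (pval_eq0 mod_xy).
Qed.

Section IntoModule.
Context (M : lmodType K) (D : K -> M).
Hypothesis derD : is_derivation iota D.

Lemma derivation_pth_power u : D (u ^+ p) = 0.
Proof. by rewrite (derivation_exp derD) (pcharf0 charKp) mul0r scale0r. Qed.

(** Derivations treat p-th powers as constants, so each one is determined by its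
    value at x. *)
Lemma derivation_frob_val Q : D (frob_val Q) = frob_val Q^`() *: D x.
Proof.
rewrite /frob_val (derivation_horner derD) => [|i].
  by rewrite deriv_map.
by rewrite coef_map /= pFrobenius_autE derivation_pth_power.
Qed.
End IntoModule.

Context (D : K -> K^o).
Hypotheses (derD : is_derivation iota D) (Dx : (D x : K) = 1).

Lemma coordinate_kaehler : is_kaehler iota D.
Proof.
split=> // M D' derD'; split.
  exists (line_through (D' x)) => u; rewrite /= /line_through.
  have [Q _ ->] := frob_val_surj u.
  rewrite (derivation_frob_val derD) (derivation_frob_val derD').
  by rewrite Dx -[_ *: _ : K^o]/(_ * _ : K) mulr1.
move=> phi psi eq_d w; have := eq_d x; rewrite Dx => eq1.
by rewrite -[w]mulr1 -[w * 1]/(w *: (1 : K^o)) !linearZ /= eq1.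
Qed.

(** K is quadratic over F(x), and an element z outside F(x) differs from its
    conjugate because 2 is invertible; (T - z) (T - z') then has coefficients in
    F(x) and distinct roots. *)
Lemma separating_absc : (2 != 0 :> F) -> odd (size f).-1 -> separating iota x.
Proof.
move=> nz2 oddf z; have [_ y2 gen] := mod_xy; have [a [b [c [nzc zE]]]] := gen z.
have nzEc : E c != 0 by rewrite (pval_eq0 mod_xy).
have adj (a' c' : {poly F}) : c' != 0 -> in_adjoin iota x (E a' / E c').
  by move=> nzc'; exists a', c'; split=> //; rewrite pvalE (pval_eq0 mod_xy).
have adj0 : in_adjoin iota x 0.
  by have := adj 0 _ nzc; rewrite rmorph0 mul0r.
have adj1 : in_adjoin iota x 1.
  by have := adj 1 1 (oner_neq0 _); rewrite rmorph1 divr1.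
have nz2K : 2 != 0 :> K by rewrite -(rmorph_nat iota) fmorph_eq0.
have z_eq : z = (E a + E b * y) / E c by rewrite -zE mulfK.
have [b0|nzb] := eqVneq b 0.
  exists ('X - z%:P); split.
  - by have := separable_prod_XsubC [:: z]; rewrite big_seq1.
  - by rewrite root_XsubC.
  case=> [|[|i]]; rewrite coefB coefX coefC /= ?sub0r ?subr0 ?oppr0 //.
  by rewrite z_eq b0 rmorph0 mul0r addr0 -mulNr -rmorphN; apply: adj.
pose z' := (E a - E b * y) / E c.
exists (\prod_(t <- [:: z; z']) ('X - t%:P)); split.
- rewrite separable_prod_XsubC /= andbT inE z_eq /z' -subr_eq0 -mulrBl.
  rewrite (_ : _ - _ = 2 * E b * y); last by ring.
  by rewrite !mulf_neq0 ?invr_eq0 ?(pval_eq0 mod_xy) ?(model_ordinate_neq0 oddf mod_xy).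
- by rewrite root_prod_XsubC inE eqxx.
rewrite big_cons big_seq1 => i.
have -> : ('X - z%:P) * ('X - z'%:P) = 'X^2 + (E (- 2 * a) / E c)%:P * 'X
    + (E (a ^+ 2 - b ^+ 2 * f) / E (c ^+ 2))%:P :> {poly K}.
  have -> : E (-2 * a) / E c = - (z + z').
    by rewrite rmorphM rmorphN rmorph_nat z_eq /z'; field.
  have -> : E (a ^+ 2 - b ^+ 2 * f) / E (c ^+ 2) = z * z'.
    by rewrite rmorphB !rmorphM -y2 z_eq /z'; field.
  by move: (z') => t; rewrite polyCN polyCD polyCM; ring.
rewrite !coefD coefXn coefCM coefX coefC.
case: i => [|[|[|i]]] /=; rewrite ?mulr0 ?mulr1 ?addr0 ?add0r //.
  by apply: adj; rewrite expf_neq0.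
exact: adj.
Qed.

(** Differentiating the expansion of w in 1, x, ..., x^(p-1) over K^p leaves no
    term in x^(p-1). *)
Lemma exact_cartier0 w : (2 != 0 :> F) -> odd (size f).-1 -> 
  cartier iota p D (D w) 0.
Proof.
move=> nz2 oddf; have [Q szQ ->] := frob_val_surj w.
exists x, (fun i => Q^`()`_i); split; first exact: separating_absc.
  have szQ' : (size (map_poly frob Q^`()) <= p)%N.
    apply: leq_trans (size_poly _ _) _.
    exact: leq_trans (size_poly _ _) (leq_trans (leq_pred _) szQ).
  rewrite (derivation_frob_val derD); congr (_ *: _).
  rewrite /frob_val (horner_coef_wide _ szQ') big_mkord; apply: eq_bigr => i _.
  by rewrite coef_map /= pFrobenius_autE.
by rewrite coef_deriv prednK // nth_default // mul0rn scale0r.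
Qed.

(** The terms f_i^p t^i dt with i < p - 1 are the differentials of
    f_i^p t^(i+1) / (i+1). *)
Lemma cartier0_exact u : cartier iota p D u 0 -> exists w, D w = u.
Proof.
have [Da Dm Dc] := derD.
move=> [t [g [_ uE /esym/eqP]]]; rewrite scaler_eq0 => /orP[/eqP g0|/eqP Dt0]; last first.
  by exists 0; rewrite uE Dt0 scaler0 (derivation0 derD).
pose c i : K := g i ^+ p * iota (i.+1%:R^-1).
have D_c i : D (c i) = 0.
  by rewrite Dm Dc (derivation_pth_power derD) !scaler0 addr0.
have D_term i : (i < p.-1)%N -> D (c i * t ^+ i.+1) = (g i ^+ p * t ^+ i) *: D t.
  move=> ltip; rewrite Dm D_c scaler0 addr0 (derivation_exp derD) scalerA.
  congr (_ *: _); rewrite /c fmorphV rmorph_nat mulrA mulfVK //.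
  rewrite -(dvdn_pcharf charKp) gtnNdvd //.
  by move: ltip p_gt2; lia.
exists (\sum_(0 <= i < p.-1) c i * t ^+ i.+1).
rewrite (derivation_sum derD) uE -[in RHS](prednK p_gt0) big_nat_recr //=.
rewrite [X in _ + X](_ : _ = 0) ?addr0; last first.
  by rewrite g0 exprS !mul0r.
rewrite scaler_suml; apply: eq_big_nat => i /andP[_ ltip].
by rewrite prednK //; apply: D_term.
Qed.

Lemma iter_derivation_pval n P : iter n (D : K -> K) (E P) = E P^`(n).
Proof.
elim: n => [|n IHn]; first by rewrite derivn0.
by rewrite iterS IHn (derivation_pval derD) Dx derivnS -[_ *: _]/(_ * _) mulr1.
Qed.

Lemma iter_derivation_frob_val n Q :
  iter n (D : K -> K) (frob_val Q) = frob_val Q^`(n).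
Proof.
elim: n => [|n IHn]; first by rewrite derivn0.
by rewrite iterS IHn (derivation_frob_val derD) Dx derivnS -[_ *: _]/(_ * _) mulr1.
Qed.

(** The p-th iterate of D is zero, so D w = P(x) forces the (p-1)-st derivative
    of P to vanish; this kills exactly the exponents l p + p - 1, whose
    factor is (p-1)! modulo p.  Without these exponents P has an antiderivative. *)
Lemma exact_pval (P : {poly F}) :
  (exists w, D w = E P) <-> forall l, P`_(l * p + p.-1) = 0.
Proof.
have p_pr := char_prime; split=> [[w DwE] l | P0].
  have DpE : E P^`(p.-1) = 0.
    have [Q szQ wE] := frob_val_surj w.
    rewrite -iter_derivation_pval -DwE wE -iterSr prednK //.
    by rewrite iter_derivation_frob_val derivn_poly0 // /frob_val rmorph0 horner0.
  have /eqP := DpE; rewrite (pval_eq0 mod_xy) => /eqP.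
  move/(congr1 (fun q : {poly F} => q`_(l * p))); rewrite coef0 coef_derivn.
  rewrite addnC -mulr_natr => /eqP; rewrite mulf_eq0 => /orP[/eqP //|].
  rewrite -(dvdn_pcharf charFp) ffact_prod Euclid_dvd_prod // big_has.
  case/hasP=> j _; have ltj := ltn_ord j; rewrite -addnBA; last exact: ltnW.
  by rewrite dvdn_addr ?dvdn_mull // gtnNdvd //; move: p_gt0 ltj; lia.
exists (E (\poly_(i < (size P).+1) (P`_i.-1 / i%:R))).
rewrite (derivation_pval derD) Dx -[_ *: _]/(_ * _) mulr1; congr (E _).
apply/polyP=> i; rewrite coef_deriv coef_poly ltnS /=.
have [szi|ltis] := leqP (size P) i.
  by rewrite mul0rn nth_default.
have [pi|npi] := boolP (p %| i.+1)%N; last first.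
  by rewrite -[LHS]mulr_natr divfK // -(dvdn_pcharf charFp).
have [[|l] def_i] := dvdnP pi; first by lia.
have -> : i = (l * p + p.-1)%N by rewrite mulSn in def_i; lia.
by rewrite P0 !mul0r mul0rn.
Qed.

Lemma exact_mul_pth_power u c : (exists w, D w = u) -> exists w, D w = u * c ^+ p.
Proof.
have [_ Dm _] := derD => -[w <-]; exists (w * c ^+ p).
by rewrite Dm (derivation_pth_power derD) scaler0 add0r -[_ *: _]/(_ * _) mulrC.
Qed.

(** y^p = f(x)^h y, and p-th powers are constants for D. *)
Lemma exact_quotient (a : {poly F}) : y != 0 ->
  (exists w, D w = E a / y) <-> exists w, D w = E (a * f ^+ p./2).
Proof.
move=> nzy; have quot : E a / y * y ^+ p = E (a * f ^+ p./2).
  have [_ y2 _] := mod_xy; rewrite rmorphM rmorphXn -y2 -exprM.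
  by rewrite [in y ^+ p]p_half exprS mulrA divfK.
split=> /exact_mul_pth_power; first by move/(_ y); rewrite quot.
by move/(_ y^-1); rewrite -quot exprVn mulfK // expf_neq0.
Qed.
End PBasis.


(** * The coefficients of a f^h *)

Section Hasse.
Context (F : fieldType) (p k m : nat).
Hypotheses (charFp : p \in [pchar F]) (p_gt2 : (2 < p)%N) (def_m : m = ((2 * k + 1) * p)%N).
Local Notation h := (p./2).

Lemma half_p : p = (2 * h).+1.
Proof. exact: odd_prime_half (pcharf_prime charFp) p_gt2. Qed.

Lemma coef_hasse_mul (a : {poly F}) n :
  (a * ('X^m + 'X) ^+ h)`_n
  = \sum_(j < h.+1) (if (n < h - j + m * j)%N then 0
                     else a`_(n - (h - j + m * j))) *+ 'C(h, j).
Proof.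
rewrite addrC exprDn mulr_sumr coef_sum; apply: eq_bigr => j _.
by rewrite mulrnAr coefMn -exprM -exprD coefMXn.
Qed.

(** C(h, j) divides h!, which has no factor p because h < p. *)
Lemma bin_half_neq0 j : (j <= h)%N -> 'C(h, j)%:R != 0 :> F.
Proof.
move=> lejh; rewrite -(dvdn_pcharf charFp).
have p_pr := pcharf_prime charFp; have := half_p; move: lejh.
have: (h < p)%N by have := half_p; lia.
move: h => n ltnp lejn _; apply/negP => pC.
have : (p %| n`!)%N by rewrite -(bin_fact lejn) dvdn_mulr.
rewrite fact_prod Euclid_dvd_prod // big_has => /hasP[i].
by rewrite mem_index_iota => /andP[i_gt0 lt_i]; rewrite gtnNdvd //; lia.
Qed.

Lemma hasse_exponent_lt l j : (j <= h)%N ->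
  (l * p + p.-1 < h - j + m * j)%N = (l < (2 * k + 1) * j)%N.
Proof.
move=> lejh; rewrite def_m mulnAC; move: ((2 * k + 1) * j)%N => t.
have [letl|ltlt] := leqP t l.
  have : (t * p <= l * p)%N by rewrite leq_mul2r letl orbT.
  by have := half_p; lia.
have : (l.+1 * p <= t * p)%N by rewrite leq_mul2r ltlt orbT.
by rewrite mulSn; have := half_p; lia.
Qed.

Lemma hasse_exponent l j : (j <= h)%N -> ((2 * k + 1) * j <= l)%N ->
  (l * p + p.-1 - (h - j + m * j) = (l - (2 * k + 1) * j) * p + (h + j))%N.
Proof.
move=> lejh; rewrite def_m mulnAC; move: ((2 * k + 1) * j)%N => t letl.
have : (t * p <= l * p)%N by rewrite leq_mul2r letl orbT.
by rewrite mulnBl; have := half_p; lia.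
Qed.

(** Put s = 2 k + 1.  For l = s j + i with i < s and j <= h, the coefficient of
    X^(l p + p - 1) in a f^h is C(h, j) times that of X^(i p + h + j) in a, since
    the other terms of the expansion of f^h would need coefficients of a at a
    negative exponent or beyond the degree bound.  As i and j vary, i p + h + j
    runs over the exponents in question. *)
Lemma hasse_kernel (a : {poly F}) : (size a <= k * p + h)%N ->
  (forall l, (a * ('X^m + 'X) ^+ h)`_(l * p + p.-1) = 0)
  <-> (forall i, (h <= i %% p)%N -> a`_i = 0).
Proof.
move=> sza; have def_p := half_p; split=> a0; last first.
  move=> l; rewrite coef_hasse_mul big1 // => j _.
  have lejh : (j <= h)%N by rewrite -ltnS.
  rewrite hasse_exponent_lt //; case: ltnP => [|le_l]; first by rewrite mul0rn.
  rewrite hasse_exponent // a0 ?mul0rn //.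
  by rewrite modnMDl modn_small; lia.
move=> i hi; have [/(leq_trans sza)|] := leqP (k * p + h) i.
  exact: nth_default.
have p_gt0 : (0 < p)%N by lia.
have := ltn_pmod i p_gt0; have := divn_eq i p; move: hi.
move: (i %/ p)%N (i %% p)%N => i1 i0 hi0 def_i lt_i0 lti.
have lt_i1 : (i1 < k)%N.
  rewrite ltnNge; apply/negP => lek.
  have : (k * p <= i1 * p)%N by rewrite leq_mul2r lek orbT.
  by lia.
(* i = i1 p + h + j is reached from l = i1 + s j *)
pose j := (i0 - h)%N; have lejh : (j < h.+1)%N by rewrite /j; lia.
have := a0 (i1 + (2 * k + 1) * j)%N; rewrite coef_hasse_mul.
rewrite (bigD1 (Ordinal lejh)) //= big1 ?addr0 => [|j' nej].
  rewrite hasse_exponent_lt // ltnNge leq_addl /= hasse_exponent ?leq_addl //.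
  rewrite addnK (_ : _ + _ = i)%N; last by rewrite /j; lia.
  by rewrite -mulr_natr => /eqP; rewrite mulf_eq0 (negPf (bin_half_neq0 _)) // orbF => /eqP.
have lej'h : (j' <= h)%N by rewrite -ltnS.
rewrite hasse_exponent_lt //; case: ltnP => [|le_l]; first by rewrite mul0rn.
rewrite hasse_exponent // nth_default ?mul0rn // (leq_trans sza) //.
have ltj : (j' < j)%N.
  rewrite ltn_neqAle; apply/andP; split.
    by apply: contraNneq nej => eq_j; apply/eqP/val_inj.
  rewrite leqNgt; apply/negP => ltjj.
  have : ((2 * k + 1) * j.+1 <= (2 * k + 1) * j')%N by rewrite leq_mul2l ltjj orbT.
  by rewrite mulnS; lia.
have : ((2 * k + 1) * j'.+1 <= (2 * k + 1) * j)%N by rewrite leq_mul2l ltj orbT.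
rewrite mulnS => le_sj.
have le_kl : (k.+1 <= i1 + (2 * k + 1) * j - (2 * k + 1) * j')%N by lia.
apply: leq_trans (leq_addr _ _); apply: leq_trans (leq_mul le_kl (leqnn p)).
by rewrite mulSn; lia.
Qed.
End Hasse.

(** * The normal form of the elements of the function field *)

Section FieldModel.
Context (F : closedFieldType) (K : fieldType) (iota : {rmorphism F -> K}).
Context (f : {poly F}) (x y : K).
Hypotheses (oddf : odd (size f).-1) (defK : hyperelliptic_function_field iota f x y).
Local Notation E := (pval iota x).

Let coordinate_ring z := exists a b, z = E a + E b * y.

Lemma coordinate_ring_horner (P : {poly {poly F}}) :
  coordinate_ring (map_poly (map_poly iota) P).[x, y].
Proof.
have [_ y2 _] := defK; rewrite pvalE in y2.
have line (a b c : {poly F}) z : coordinate_ring z ->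
    coordinate_ring (z * (E a + E b * y) + E c).
  move=> [a1 [b1 ->]]; exists (a1 * a + b1 * b * f + c), (a1 * b + b1 * a).
  by rewrite !(rmorphD, rmorphM) -y2; ring.
have coordD u v : coordinate_ring u -> coordinate_ring v -> coordinate_ring (u + v).
  move=> [a [b ->]] [a1 [b1 ->]]; exists (a + a1), (b + b1).
  by rewrite !rmorphD; ring.
have coord_y (q : {poly F}) : coordinate_ring (map_poly iota q).[y].
  elim/poly_ind: q => [|q c IHq].
    by exists 0, 0; rewrite !rmorph0 horner0 mul0r addr0.
  have := line 0 1 c%:P _ IHq.
  by rewrite rmorph0 rmorph1 mul1r add0r pvalC rmorphD rmorphM /= map_polyX map_polyC !hornerE.
elim/poly_ind: P => [|P c IHP].
  by exists 0, 0; rewrite !rmorph0 !horner0 mul0r addr0.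
rewrite rmorphD rmorphM /= map_polyX map_polyC !hornerE; apply: coordD; last exact: coord_y.
have := line 'X 0 0 _ IHP.
by rewrite !rmorph0 pvalX mul0r !addr0.
Qed.

(** Rationalising the denominator: the norm c^2 - d^2 f of c + d y is a nonzero
    polynomial in x. *)
Lemma function_field_model : model iota f x y.
Proof.
have [tr y2 gen] := defK; rewrite pvalE in y2; split=> // z.
have [A [B [nzB ->]]] := gen z; rewrite -/(_ .[x, y]).
have [a [b AE]] := coordinate_ring_horner A.
have [c [d BE]] := coordinate_ring_horner B.
rewrite AE BE in nzB *.
exists (a * c - b * d * f), (b * c - a * d), (c ^+ 2 - d ^+ 2 * f); split.
  apply: contraNneq nzB => /subr0_eq/(odd_sqr_eq oddf)[-> ->].
  by rewrite !rmorph0 mul0r addr0.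
rewrite !(rmorphB, rmorphM) -y2; field; exact: nzB.
Qed.

End FieldModel.

(** * The basis of the space of exact holomorphic differentials *)

Section MonomialBasis.
Context (F : fieldType) (p h k : nat).
Hypotheses (h_gt0 : (0 < h)%N) (lt_hp : (h < p)%N).

(** The numbers that leave a remainder less than h modulo p, in increasing
    order. *)
Definition basis_exponent (i : nat) : nat := ((i %/ h) * p + i %% h)%N.

Definition monomial_sum (c : 'I_(k.+1 * h) -> F) : {poly F} :=
  \sum_i c i *: 'X^(basis_exponent i).

Lemma basis_exponent_divn i : (basis_exponent i %/ p = i %/ h)%N.
Proof.
have p_gt0 : (0 < p)%N by apply: leq_ltn_trans lt_hp.
by rewrite divnMDl // [X in (_ + X)%N]divn_small ?addn0 // (ltn_trans (ltn_pmod _ h_gt0)).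
Qed.

Lemma basis_exponent_modn i : (basis_exponent i %% p = i %% h)%N.
Proof. by rewrite modnMDl modn_small // (ltn_trans (ltn_pmod _ h_gt0)). Qed.

Lemma basis_exponent_inj : injective basis_exponent.
Proof.
move=> i j eq_ij; rewrite (divn_eq i h) (divn_eq j h).
by rewrite -!basis_exponent_divn -!basis_exponent_modn eq_ij.
Qed.

Lemma coef_monomial_sum c (i : 'I_(k.+1 * h)) :
  (monomial_sum c)`_(basis_exponent i) = c i.
Proof.
rewrite coef_sum (bigD1 i) //= coefZ coefXn eqxx mulr1 big1 ?addr0 // => j nej.
rewrite coefZ coefXn (inj_eq basis_exponent_inj) (inj_eq val_inj) eq_sym.
by rewrite (negPf nej) mulr0.
Qed.

Lemma coef_monomial_sum_eq0 c n :
  (forall i : 'I_(k.+1 * h), basis_exponent i != n) -> (monomial_sum c)`_n = 0.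
Proof.
move=> nexp; rewrite coef_sum big1 // => i _.
by rewrite coefZ coefXn eq_sym (negPf (nexp i)) mulr0.
Qed.

Lemma size_monomial_sum c : (size (monomial_sum c) <= k * p + h)%N.
Proof.
apply/leq_sizeP => n len; apply: coef_monomial_sum_eq0 => i.
have lt_i : (i %/ h <= k)%N by rewrite -ltnS ltn_divLR.
apply: contraTneq len => <-; rewrite -ltnNge /basis_exponent -addnS.
by rewrite leq_add ?ltn_pmod // leq_mul2r lt_i orbT.
Qed.

Lemma coef_monomial_sum_mod c n : (h <= n %% p)%N -> (monomial_sum c)`_n = 0.
Proof.
move=> len; apply: coef_monomial_sum_eq0 => i; apply: contraTneq len => <-.
by rewrite basis_exponent_modn -ltnNge ltn_pmod.
Qed.

Lemma monomial_sum_surj (a : {poly F}) : (size a <= k * p + h)%N ->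
  (forall n, (h <= n %% p)%N -> a`_n = 0) -> exists c, a = monomial_sum c.
Proof.
move=> sza a0; exists (fun i => a`_(basis_exponent i)); apply/polyP => n.
have [len|ltn] := leqP h (n %% p); first by rewrite a0 // coef_monomial_sum_mod.
have [len|lt_n] := leqP (k * p + h) n.
  rewrite !nth_default //; last exact: leq_trans len.
  exact: leq_trans (size_monomial_sum _) len.
have p_gt0 : (0 < p)%N by apply: leq_ltn_trans lt_hp.
have lek : (n %/ p <= k)%N.
  rewrite -ltnS ltn_divLR // mulSn (leq_trans lt_n) // addnC leq_add2r.
  exact: ltnW.
have lti : (n %/ p * h + n %% p < k.+1 * h)%N.
  rewrite mulSn addnC -addSn leq_add // leq_mul2r lek orbT //.
have exp_i : basis_exponent (Ordinal lti) = n.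
  rewrite /basis_exponent /= divnMDl // (divn_small ltn) addn0.
  by rewrite modnMDl modn_small // -divn_eq.
by rewrite -{2}exp_i coef_monomial_sum exp_i.
Qed.

End MonomialBasis.

(** * The a-number *)

Theorem theorem4p1 (F : closedFieldType) (p : nat) (charFp : p \in [pchar F])
    (p_gt2 : (2 < p)%N) (k s m : nat) (def_s : s = (2 * k + 1)%N)
    (def_m : m = (s * p)%N)
    (K : fieldType) (iota : {rmorphism F -> K}) (x y : K)
    (defK : hyperelliptic_function_field iota ('X^m + 'X) x y) :
  has_a_number iota p ((k + 1) * (p - 1) %/ 2)%N.
Proof.
have p_half := odd_prime_half (pcharf_prime charFp) p_gt2.
set h := p./2 in p_half.
have -> : ((k + 1) * (p - 1) %/ 2 = k.+1 * h)%N.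
  by rewrite p_half subn1 /= mulnCA mulKn // addn1.
pose g := (k * p + h)%N.
have m_g : m = (2 * g).+1 by rewrite def_m def_s /g mulnDl; lia.
have h_gt0 : (0 < h)%N by lia.
have lt_hp : (h < p)%N by lia.
have g_gt0 : (0 < g)%N by rewrite addn_gt0 h_gt0 orbT.
have m0 : m%:R = 0 :> F by apply/eqP; rewrite -(dvdn_pcharf charFp) def_m dvdn_mull.
have nz2 : 2 != 0 :> F by rewrite -(dvdn_pcharf charFp) gtnNdvd.
have oddf : odd (size ('X^m + 'X : {poly F})).-1.
  by apply: odd_size_curve; rewrite m_g ?ltnS ?muln_gt0 //= mul2n odd_double.
have df := deriv_curve m0.
have mod_xy := function_field_model oddf defK.
have nzy := model_ordinate_neq0 oddf mod_xy.
have derD := coord_der_derivation oddf mod_xy nz2 df.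
have Dx := coord_der_absc oddf mod_xy nz2 df.
set D := coord_der _ in derD Dx.
exists K^o, D; split; first exact: (coordinate_kaehler charFp p_gt2 mod_xy derD Dx).
have sum_basis (c : 'I_(k.+1 * h) -> F) :
    \sum_i iota (c i) *: (x ^+ basis_exponent p h i / y : K^o)
    = pval iota x (monomial_sum p c) / y.
  rewrite rmorph_sum mulr_suml; apply: eq_bigr => i _.
  by rewrite -mul_polyC rmorphM pvalC pvalXn -mulrA.
exists (fun i => x ^+ basis_exponent p h i / y); split=> [c|v].
  rewrite sum_basis => /eqP; rewrite mulf_eq0 invr_eq0 (negPf nzy) orbF.
  rewrite (pval_eq0 mod_xy) => /eqP c0 i.
  by rewrite -(coef_monomial_sum h_gt0 lt_hp c i) c0 coef0.
have kernel (a : {poly F}) : (size a <= g)%N ->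
    (exists w, D w = pval iota x a / y) <->
    (forall n, (h <= n %% p)%N -> a`_n = 0).
  move=> sza; rewrite def_s in def_m.
  rewrite (exact_quotient charFp p_gt2 mod_xy derD a nzy).
  rewrite (exact_pval charFp p_gt2 mod_xy derD Dx).
  exact: (hasse_kernel charFp p_gt2 def_m sza).
split=> [[hol car]|[c ->]].
  have [a sza v_eq] := holomorphic_numerator m_g mod_xy nz2 m0 g_gt0 derD Dx hol.
  have := cartier0_exact charFp p_gt2 derD car; rewrite v_eq.
  case/(kernel a sza)/(monomial_sum_surj h_gt0 lt_hp sza)=> c ->.
  by exists c; rewrite sum_basis.
have szc : (size (monomial_sum p c) <= g)%N by apply: size_monomial_sum.
rewrite sum_basis; split.
  exact: (holomorphic_pval m_g mod_xy m0 g_gt0 derD Dx szc).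
have [|w <-] := (kernel _ szc).2; first by move=> n; apply: coef_monomial_sum_mod.
exact: (exact_cartier0 charFp p_gt2 mod_xy derD w nz2 oddf).
Qed.
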